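(* Let $p$ be a prime, let $F$ be an algebraically closed field of characteristic $p$, let $G$ be a finite group, and let $B$ be a block of the group algebra $FG$ whose defect groups are non-cyclic of order $p^{d}$. Let $ZB$ be the center of $B$ and ${\rm ll}ZB$ its Loewy length. Then \[ {\rm ll}ZB \le p^{d-1} + p - 1. \]
   Context: A block $B$ of $FG$ is an indecomposable two-sided ideal direct summand of $FG$, i.e. $B = e\,FG$ with $e$ a primitive idempotent of the center $ZFG$ of $FG$; a defect group of $B$ is understood in the usual sense of modular representation theory (it is a $p$-subgroup of $G$, unique up to $G$-conjugacy). $ZB$ denotes the center of the algebra $B$, and $JZB$ denotes the Jacobson radical of $ZB$. The Loewy length ${\rm ll}ZB$ is the nilpotency index of $JZB$, that is, the smallest positive integer $n$ such that $(JZB)^{n} = 0$. *)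

(* Defs.v *)
From HB Require Import structures.
From mathcomp Require Import all_boot all_order all_fingroup all_algebra.
From mathcomp Require Import falgebra boolp.

Set Implicit Arguments.
Unset Strict Implicit.
Unset Printing Implicit Defensive.

Import GRing.Theory.
Local Open Scope ring_scope.

(* The group algebra FG: functions G -> F with the convolution product; a g is
   the coefficient of g in a. The alias keeps this product apart from the
   pointwise one on {ffun gT -> F}. *)
Definition galg (F : fieldType) (gT : finGroupType) := {ffun gT -> F^o}.

Section GroupAlgebra.

Variables (F : fieldType) (gT : finGroupType).
Local Notation FG := (galg F gT).

HB.instance Definition _ := Vector.copy FG {ffun gT -> F^o}.

Definition galg_elt (g : gT) : FG := [ffun h => (h == g)%:R].

Definition galg_mul (a b : FG) : FG :=
  [ffun g => \sum_(x : gT) a x * b (x^-1 * g)%g].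

Fact galg_mulA : associative galg_mul.
Proof.
move=> a b c; apply/ffunP=> g; rewrite !ffunE.
under eq_bigr => x _ do rewrite ffunE mulr_sumr.
under [RHS]eq_bigr => z _ do rewrite ffunE mulr_suml.
rewrite [RHS]exchange_big; apply: eq_bigr => x _ /=.
rewrite [RHS](reindex_inj (mulgI x)); apply: eq_bigr => y _ /=.
by rewrite mulrA mulKg invMg mulgA.
Qed.

Fact galg_mul1l : left_id (galg_elt 1) galg_mul.
Proof.
move=> a; apply/ffunP=> g; rewrite ffunE (bigD1 1%g) //= big1 => [|x /negPf x1].
  by rewrite ffunE eqxx mul1r invg1 mul1g addr0.
by rewrite ffunE x1 mul0r.
Qed.

Fact galg_mul1r : right_id (galg_elt 1) galg_mul.
Proof.
move=> a; apply/ffunP=> g; rewrite ffunE (bigD1 g) //= big1 => [|x x_g].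
  by rewrite ffunE mulVg eqxx mulr1 addr0.
by rewrite ffunE -eq_invg_mul invgK (negPf x_g) mulr0.
Qed.

Fact galg_mulDl : left_distributive galg_mul +%R.
Proof.
move=> a b c; apply/ffunP=> g; rewrite !ffunE -big_split /=.
by apply: eq_bigr => x _; rewrite ffunE mulrDl.
Qed.

Fact galg_mulDr : right_distributive galg_mul +%R.
Proof.
move=> a b c; apply/ffunP=> g; rewrite !ffunE -big_split /=.
by apply: eq_bigr => x _; rewrite ffunE mulrDr.
Qed.

Fact galg_one_neq0 : galg_elt 1 != 0.
Proof.
apply/eqP=> /ffunP/(_ 1%g)/eqP.
by rewrite !ffunE eqxx /= (oner_eq0 F).
Qed.

HB.instance Definition _ := GRing.Zmodule_isNzRing.Build FG
  galg_mulA galg_mul1l galg_mul1r galg_mulDl galg_mulDr galg_one_neq0.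

Fact galg_scaleAl (k : F) (a b : FG) : k *: (a * b) = (k *: a) * b.
Proof.
apply/ffunP=> g; rewrite !ffunE scaler_sumr.
by apply: eq_bigr => x _; rewrite ffunE; apply: mulrA.
Qed.

HB.instance Definition _ := GRing.Lmodule_isLalgebra.Build F FG galg_scaleAl.

Fact galg_scaleAr (k : F) (a b : FG) : k *: (a * b) = a * (k *: b).
Proof.
apply/ffunP=> g; rewrite !ffunE scaler_sumr.
by apply: eq_bigr => x _; rewrite ffunE; apply: mulrCA.
Qed.

HB.instance Definition _ := GRing.Lalgebra_isAlgebra.Build F FG galg_scaleAr.
HB.instance Definition _ := Algebra_isFalgebra.Build F FG.

Lemma galg_eltM (g h : gT) :
  galg_elt (g * h)%g = galg_elt g * galg_elt h :> FG.
Proof.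
apply/ffunP=> x; rewrite !ffunE (bigD1 g) //= big1 => [|y /negPf y_g].
  by rewrite !ffunE eqxx mul1r addr0 (canF_eq (mulKVg g)).
by rewrite ffunE y_g mul0r.
Qed.

End GroupAlgebra.

Arguments galg_elt {F gT} g.

Section Radical.

Variables (F : fieldType) (aT : falgType F).
Implicit Types (A : {aspace aT}) (e : aT) (I J U V : {vspace aT}).

Definition primitive_idempotent A e : Prop :=
  [/\ e \in A, e != 0, e * e = e
    & forall e1 e2, e1 \in A -> e2 \in A ->
        e1 * e1 = e1 -> e2 * e2 = e2 -> e1 * e2 = 0 -> e2 * e1 = 0 ->
        e = e1 + e2 -> e1 = 0 \/ e2 = 0].

(* As A is a unital algebra, the left ideals of the ring A are automatically
   subspaces. *)
Definition left_ideal A I : bool := (I <= A)%VS && (A * I <= I)%VS.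

Definition maximal_left_ideal A I : Prop :=
  [/\ left_ideal A I, I <> A
    & forall J, left_ideal A J -> J <> A -> (I <= J)%VS -> J = I].

Fact bigcapv_exists U (P : {vspace aT} -> Prop) :
  exists J, forall x, x \in J <-> x \in U /\ (forall I, P I -> x \in I).
Proof.
have [n leUn] := ubnP (\dim U); elim: n U leUn => // n IHn U leUn.
case: (pselect (exists2 I, P I & ~~ (U <= I)%VS)) => [[I PI nUI] | noI].
  have [|J defJ] := IHn (U :&: I)%VS.
    apply: leq_trans (_ : _ < \dim U)%N leUn; rewrite ltn_neqAle dimvS ?capvSl // andbT.
    apply: contraNneq nUI => eq_dim; apply/capv_idPl/eqP.
    by rewrite eqEdim capvSl eq_dim leqnn.
  exists J => x; rewrite defJ memv_cap; split=> [[/andP[Ux _]] | [Ux allx]] //.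
  by rewrite Ux allx.
exists U => x; split=> [Ux | []//]; split=> // I PI.
by apply: contra_notT noI => nIx; exists I => //; apply: contra nIx => /subvP->.
Qed.

Definition jacobson A : {vspace aT} :=
  sval (cid (bigcapv_exists A (maximal_left_ideal A))).

Lemma jacobsonP A x :
  x \in jacobson A <->
  x \in A /\ (forall I, maximal_left_ideal A I -> x \in I).
Proof. exact: svalP (cid (bigcapv_exists A (maximal_left_ideal A))) x. Qed.

Fact jacobson_left_ideal A : left_ideal A (jacobson A).
Proof.
apply/andP; split; first by apply/subvP=> x /jacobsonP[].
apply/prodvP=> a x Aa /jacobsonP[Ax Jx]; apply/jacobsonP; split=> [|I maxI].
  exact: memvM.
have [/andP[_ AI] _ _] := maxI.
by apply: (subvP AI); apply: memv_mul => //; apply: Jx.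
Qed.

Fact maximal_submodule A V : left_ideal A V -> V != 0%VS ->
  exists N, [/\ left_ideal A N, (N <= V)%VS, N <> V
    & forall N', left_ideal A N' -> (N <= N')%VS -> (N' <= V)%VS -> N' <> V ->
        N' = N].
Proof.
move=> idV nzV.
have: exists N, [/\ left_ideal A N, (N <= V)%VS & N <> V].
  exists 0%VS; rewrite sub0v /left_ideal sub0v prodv0 subvv; split=> //.
  by apply/eqP; rewrite eq_sym.
case=> N; have [n ltN] := ubnP (\dim V - \dim N).
elim: n N ltN => // n IHn N ltN; case=> idN sNV nNV.
case: (pselect (exists N', [/\ left_ideal A N', (N <= N')%VS, (N' <= V)%VS,
  N' <> V & N' <> N])) => [[N' [idN' sNN' sN'V nN'V nN'N]] | noN].
  apply: (IHn N') => //; apply: leq_trans (_ : _ < \dim V - \dim N)%N ltN.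
  apply: ltn_sub2l.
    rewrite ltn_neqAle dimvS // andbT; apply/eqP=> eqd; apply: nNV.
    by apply/eqP; rewrite eqEdim sNV eqd leqnn.
  rewrite ltn_neqAle dimvS // andbT; apply/eqP=> eqd; apply: nN'N.
  by apply/esym/eqP; rewrite eqEdim sNN' eqd leqnn.
exists N; split=> // N' idN' sNN' sN'V nN'V.
by apply: contra_notP noN => nN'N; exists N'.
Qed.

Fact jacobson_nakayama A V : left_ideal A V -> (V <= jacobson A * V)%VS ->
  V = 0%VS.
Proof.
move=> idV sVJV; apply/eqP; apply: contraT => nzV.
have [N [idN sNV nNV maxN]] := maximal_submodule idV nzV.
have [/andP[sVA sAVV] /andP[_ sANN]] := (idV, idN).
case: nNV; apply/eqP; rewrite eqEsubv sNV (subv_trans sVJV) //.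
apply/prodvP=> a v Ja Vv; have /jacobsonP[Aa Ma] := Ja.
have [Nv | nNv] := boolP (v \in N).
  by apply: (subvP sANN); apply: memv_mul.
pose M := (A :&: amulr v @^-1: N)%VS.
have inM x : (x \in M) = (x \in A) && (x * v \in N).
  by rewrite memv_cap -memv_preim lfunE.
have Av := subvP sVA _ Vv.
suffices: a \in M by rewrite inM => /andP[].
apply: Ma; split=> [||J idJ nJA sMJ].
- rewrite /left_ideal capvSl; apply/prodvP=> x y Ax; rewrite !inM.
  case/andP=> Ay Nyv; rewrite memvM //= -mulrA (subvP sANN) //.
  exact: memv_mul.
- move=> MA; case/negP: nNv; move: (memv_algid A); rewrite -MA inM => /andP[_].
  by rewrite MA algidl.
have /andP[sJA sAJJ] := idJ.
apply/esym/eqP; rewrite eqEsubv sMJ; apply: contra_notT nJA => /subvPn[b Jb nMb].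
have Ab := subvP sJA _ Jb.
have nNbv: b * v \notin N by move: nMb; rewrite inM Ab.
pose N' := (N + amulr v @: J)%VS.
have N'bv: b * v \in N'.
  by apply: (subvP (addvSr _ _)); apply/memv_imgP; exists b; rewrite ?lfunE.
have sN'V: (N' <= V)%VS.
  rewrite subv_add sNV; apply/subvP=> _ /memv_imgP[x Jx ->]; rewrite lfunE /=.
  by apply: (subvP sAVV); rewrite memv_mul // (subvP sJA).
have N'V: N' = V.
  apply: contrapT => nN'V; case/negP: nNbv.
  rewrite -(maxN N') ?addvSl // /left_ideal (subv_trans sN'V) //=.
  apply/prodvP=> x _ Ax /memv_addP[y Ny [_ /memv_imgP[z Jz ->] ->]].
  rewrite lfunE /= mulrDr mulrA memv_add ?(subvP sANN) ?memv_mul //.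
  by apply/memv_imgP; exists (x * z); rewrite ?lfunE // (subvP sAJJ) ?memv_mul.
move: Vv; rewrite -N'V => /memv_addP[y Ny [_ /memv_imgP[c Jc ->]]].
rewrite lfunE /= => def_v.
have Jid: algid A \in J.
  rewrite -(subrK c (algid A)) memvD // (subvP sMJ) // inM.
  rewrite memvB ?memv_algid ?(subvP sJA) //= mulrBl algidl //.
  by rewrite {1}def_v addrK.
apply/eqP; rewrite eqEsubv sJA; apply/subvP=> x Ax.
by rewrite -(algidr Ax) (subvP sAJJ) // memv_mul.
Qed.

Fact jacobson_nilpotent A :
  exists n, (0 < n)%N && (jacobson A ^+ n == 0)%VS.
Proof.
set J := jacobson A; have /andP[sJA sAJJ] := jacobson_left_ideal A.
have idX n : left_ideal A (J ^+ n.+1)%VS.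
  apply/andP; split; first by rewrite -(expv_id A n) expvS.
  by rewrite expvSl prodvA prodvSl.
have sX n : (J ^+ n.+2 <= J ^+ n.+1)%VS.
  rewrite expvSl; have /andP[_] := idX n; apply: subv_trans.
  exact: prodvSl.
have [n] : exists n, (J ^+ n.+1 <= J ^+ n.+2)%VS.
  apply: contrapT => noN.
  have dimX n : (\dim (J ^+ n.+1) + n <= \dim J)%N.
    elim: n => [|n IHn]; first by rewrite expv1 addn0.
    rewrite addnS -addSn; apply: leq_trans IHn; rewrite leq_add2r.
    rewrite ltn_neqAle dimvS ?sX // andbT; apply/eqP=> eqd; apply: noN.
    exists n; suffices <- : (J ^+ n.+2 = J ^+ n.+1)%VS by [].
    by apply/eqP; rewrite eqEdim sX eqd leqnn.
  by have := dimX (\dim J).+1; rewrite addnS ltnNge leq_addl.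
rewrite (expvSl _ n.+1) => /(jacobson_nakayama (idX n)) X0.
by exists n.+1; rewrite X0 eqxx.
Qed.

Definition loewy_length A : nat := ex_minn (jacobson_nilpotent A).

Lemma loewy_lengthP A n : (0 < n)%N ->
  (loewy_length A <= n)%N = (jacobson A ^+ n == 0)%VS.
Proof.
rewrite /loewy_length => n_gt0; case: ex_minnP => m /andP[_ /eqP Jm0] min_m.
apply/idP/idP=> [le_mn | Jn0]; last by rewrite min_m // n_gt0.
by rewrite -(subnK le_mn) expvD Jm0 prodv0.
Qed.

End Radical.

Section Blocks.

Variables (F : fieldType) (gT : finGroupType).
Local Notation FG := (galg F gT).
Implicit Types (a b : FG) (B : {aspace FG}) (D H : {group gT}).

Definition is_block B : Prop :=
  exists2 e : FG, primitive_idempotent 'Z({:FG})%AS e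
                & B = (<[e]> * {:FG})%VS :> {vspace FG}.

(* The identity element of a block is its block idempotent. *)
Lemma is_block_algid B : is_block B ->
  primitive_idempotent 'Z({:FG})%AS (algid B) /\
  B = (<[algid B]> * {:FG})%VS :> {vspace FG}.
Proof.
case=> e prim_e defB; suffices -> : algid B = e by [].
have [_ _ ee _] := prim_e.
have Be: e \in B by rewrite defB -{1}[e]mulr1 memv_mul ?memv_line ?memvf.
have sBe: (B <= lker (amull e - \1%VF))%VS.
  rewrite defB; apply/prodvP=> _ y /vlineP[k ->] _.
  rewrite memv_ker add_lfunE opp_lfunE id_lfunE lfunE /=.
  by rewrite -scalerAl -scalerAr mulrA ee subrr.
have := subvP sBe _ (memv_algid B).
rewrite memv_ker add_lfunE opp_lfunE id_lfunE lfunE /= algidr // subr_eq0.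
by move/eqP.
Qed.

Definition galg_conj a (x : gT) : FG := galg_elt (x^-1)%g * a * galg_elt x.

Definition galg_fixed H a : Prop := {in H, forall h, galg_conj a h = a}.

(* The relative trace map from the H-fixed points of FG to the center of FG. *)
Definition galg_trace H a : FG :=
  \sum_(X in rcosets H [set: gT]) galg_conj a (repr X).

Definition relatively_projective H a : Prop :=
  exists2 b, galg_fixed H b & a = galg_trace H b.

(* A defect group is a minimal subgroup D such that the block idempotent is a
   relative trace from the D-fixed points of FG; it is a p-group, unique up to
   conjugation in the whole group. *)
Definition defect_group B D : Prop :=
  relatively_projective D (algid B) /\
  (forall H, relatively_projective H (algid B) -> H \subset D -> H = D).

End Blocks.

(* Main.v *)
(* The bound proved is ll ZB <= max ll FM, with M running over the abelian
   subgroups of D; if |M| < |D| then ll FM <= |M| <= p^(d-1), and if M = D is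
   noncyclic then D = A x K with A cyclic and A, K nontrivial, so that
   ll FD <= |A| + |K| - 1 <= p^(d-1) + p - 1.

   Let x = j_1 ... j_n e with j_i in JZB and e the block idempotent, and let
   I(M) be the augmentation ideal of FM. By induction on n, for every abelian
   p-subgroup E and every b in FE killed by I(M)^n for each abelian M containing
   E that is conjugate into D, the element b x vanishes on C_G(E); then take
   E = 1 and b = 1. For n = 0, either M = E is allowed and b = 0, or e vanishes
   on C_G(E) because it is a relative trace from D. For the step put c = b x,
   with b killed by the I(M)^(n+1). If t is a p-element and s a p'-element of
   C_G(E) with ts = st, then c(ts) - c(s) is the value at s of
   (t^-1 - 1) b x, which is 0 by induction applied to E<t> and (t^-1 - 1) b.
   So c is constant on the p-sections of C_G(E), and multiplication by a central
   nilpotent element kills such a class function. *)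
Require Import Defs.
From mathcomp Require Import all_boot all_order all_fingroup all_algebra.
From mathcomp Require Import all_solvable falgebra boolp zify.

Set Implicit Arguments.
Unset Strict Implicit.
Unset Printing Implicit Defensive.

Import GroupScope GRing.Theory.
Local Open Scope ring_scope.

(** * Orbit sums modulo p *)

Section FixedPointSums.

Variables (F : fieldType) (p : nat).
Hypothesis pF : p \in [pchar F].

(** An orbit of non-fixed points has length divisible by p and [f] is constant on it, so it
    contributes 0 in characteristic p. *)
Lemma sum_pgroup_fix (aT : finGroupType) (sT : finType)
    (to : {action aT &-> sT}) (P : {group aT}) (S : {set sT}) (f : sT -> F) :
    p.-group P -> [acts P, on S | to] ->
    {in P & S, forall a x, f (to x a) = f x} ->
  \sum_(x in S) f x = \sum_(x in 'Fix_(S | to)(P)) f x.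
Proof.
move=> pP actS fP; have p_pr := pcharf_prime pF.
rewrite (big_setID 'Fix_to(P)) /= [X in _ + X](_ : _ = 0) ?addr0 //.
have actD : [acts P, on S :\: 'Fix_to(P) | to].
  by rewrite actsD ?acts_fix_norm ?normG.
rewrite (set_partition_big _ (orbit_partition actD)) /=.
apply: big1 => _ /imsetP[x /setDP[Sx nfx] ->].
rewrite (eq_bigr (fun=> f x)) => [|_ /imsetP[a Pa ->]]; last exact: fP.
rewrite sumr_const; suffices /dvdnP[k ->] : (p %| #|orbit to P x|)%N.
  by rewrite mulrnA mulrn_pchar.
have: p.-nat #|orbit to P x| by rewrite (pnat_dvd (dvdn_orbit to P x)).
case/p_natP=> [[|k] ox]; last by rewrite ox expnS dvdn_mulr.
by case/negP: nfx; apply/orbit1P/card_orbit1.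
Qed.

End FixedPointSums.

(** * Coefficients in the group algebra *)

Section GroupAlgebra.

Variables (F : fieldType) (gT : finGroupType).
Local Notation FG := (galg F gT).
Implicit Types (a b c : FG) (g h : gT).

Lemma galg_mulE a b g : (a * b) g = \sum_x a x * b (x^-1 * g)%g :> F.
Proof. by rewrite ffunE. Qed.

Lemma galg_eltE h g : (galg_elt h : FG) g = (g == h)%:R :> F.
Proof. by rewrite ffunE. Qed.

Lemma galg_oneE g : (1 : FG) g = (g == 1%g)%:R :> F.
Proof. exact: galg_eltE. Qed.

Lemma galg_mul_eltl h a g : (galg_elt h * a) g = a (h^-1 * g)%g :> F.
Proof.
rewrite galg_mulE (bigD1 h) //= galg_eltE eqxx mul1r big1 ?addr0 // => x.
by rewrite galg_eltE => /negPf->; rewrite mul0r.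
Qed.

Lemma galg_mul_eltr h a g : (a * galg_elt h) g = a (g * h^-1)%g :> F.
Proof.
rewrite galg_mulE (bigD1 (g * h^-1)%g) //= galg_eltE invMg invgK mulgKV.
rewrite eqxx mulr1 big1 ?addr0 // => x nx; rewrite galg_eltE.
case: ((x^-1 * g)%g =P h) nx => [<-|_ _]; last by rewrite mulr0.
by rewrite invMg invgK mulKVg eqxx.
Qed.

Lemma galg_linE (l : F) a b g : (l *: a + b) g = l * a g + b g :> F.
Proof. by rewrite !ffunE. Qed.

Lemma galg_subE a b g : (a - b) g = a g - b g :> F.
Proof. by rewrite !ffunE. Qed.

Lemma galg_sum_elt a : a = \sum_g a g *: galg_elt g.
Proof.
apply/ffunP=> h; rewrite sum_ffunE (bigD1 h) //= !ffunE eqxx big1.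
  by rewrite addr0 /GRing.scale /= mulr1.
by move=> g /negPf nhg; rewrite !ffunE eq_sym nhg /GRing.scale /= mulr0.
Qed.

Lemma galg_supp_comm (A : {set gT}) a h :
    (forall g, g \notin A -> a g = 0) -> h \in 'C(A)%g ->
  GRing.comm a (galg_elt h).
Proof.
move=> aA Ch; apply: commr_sym; rewrite (galg_sum_elt a).
apply: commr_sum => g _; rewrite /GRing.comm -scalerAl -scalerAr -!galg_eltM.
have [Ag|/aA->] := boolP (g \in A); last by rewrite !scale0r.
by rewrite (centP Ch).
Qed.

Lemma galg_eltX h n : galg_elt (h ^+ n)%g = galg_elt h ^+ n :> FG.
Proof. by elim: n => // n IHn; rewrite expgS exprS galg_eltM IHn. Qed.

Lemma galg_elt_prod (I : Type) (r : seq I) (f : I -> gT) :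
  galg_elt (\prod_(i <- r) f i)%g = \prod_(i <- r) galg_elt (f i) :> FG.
Proof. by apply: big_morph => [g h|] //; apply: galg_eltM. Qed.

Lemma galg_commJ a h g :
  GRing.comm a (galg_elt h) -> a (g ^ h)%g = a g :> F.
Proof.
move=> cah; have := congr1 (fun b : FG => b (g * h)%g) cah.
by rewrite galg_mul_eltl galg_mul_eltr mulgK => ->.
Qed.

(** [ordS] is the cyclic successor: moving the first letter of a word to the end conjugates the
    product by that letter. *)
Lemma prod_ordS m (u : 'I_m.+1 -> gT) :
  (\prod_(i < m.+1) u (ordS i) = (\prod_(i < m.+1) u i) ^ u ord0)%g.
Proof.
rewrite big_ord_recr [in RHS]big_ord_recl conjgE -mulgA mulKg; congr (_ * _)%g.
  apply: eq_bigr => i _; congr (u _); apply: val_inj => /=.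
  by rewrite modn_small // ltnS.
by congr (u _); apply: val_inj; rewrite /= modnn.
Qed.

Lemma iter_ordS m k (i : 'I_m) : iter k (@ordS m) i = ((i + k) %% m)%N :> nat.
Proof.
elim: k => [|k IHk]; first by rewrite addn0 modn_small.
by rewrite iterS /= IHk -addn1 modnDml addn1 addnS.
Qed.

Definition rot_ffun q (u : {ffun 'I_q -> gT}) : {ffun 'I_q -> gT} :=
  [ffun i => u (ordS i)].

Lemma rot_ffun_inj q : injective (@rot_ffun q).
Proof.
move=> u v /ffunP eq_uv; apply/ffunP=> i.
by have:= eq_uv (ord_pred i); rewrite !ffunE ord_predK.
Qed.

Lemma iter_rot_ffun q k (u : {ffun 'I_q -> gT}) i :
  iter k (@rot_ffun q) u i = u (iter k (@ordS q) i).
Proof. by elim: k i => // k IHk i; rewrite iterS ffunE IHk -iterSr. Qed.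

(** * Powers in characteristic p and p-sections *)

Section PowerMap.

Variable p : nat.
Hypothesis pF : p \in [pchar F].

(* [k ^+ q] is a sum over words of length q. Cyclic rotation conjugates the
   product of a word, so only the constant words survive modulo p. *)
Lemma sum_classfun_pow (H : {group gT}) (k : FG) (f : gT -> F) n :
    (forall g, g \notin H -> k g = 0) ->
    {in H &, forall x y, f (x ^ y)%g = f x} ->
  \sum_g (k ^+ (p ^ n)) g * f g =
    \sum_g k g ^+ (p ^ n) * f (g ^+ (p ^ n))%g.
Proof.
move=> kH fJ; have p_pr := pcharf_prime pF; pose q := (p ^ n)%N.
have q_gt0 : (0 < q)%N by rewrite expn_gt0 prime_gt0.
pose w (u : {ffun 'I_q -> gT}) : F :=
  \prod_i k (u i) * f (\prod_(i < q) u i)%g.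
have ->: \sum_g (k ^+ q) g * f g = \sum_u w u.
  pose L (a : FG) : F := \sum_g a g * f g.
  have L_D a b : L (a + b) = L a + L b.
    by rewrite -big_split; apply: eq_bigr => g _; rewrite ffunE mulrDl.
  have L_0 : L 0 = 0 by apply: big1 => g _; rewrite ffunE mul0r.
  have L_Z (l : F) h : L (l *: (galg_elt h : FG)) = l * f h.
    rewrite /L (bigD1 h) //= big1 => [|g /negPf nhg].
      by rewrite addr0 !ffunE eqxx /GRing.scale /= mulr1.
    by rewrite !ffunE nhg /GRing.scale /= mulr0 mul0r.
  rewrite -/(L _) -[q in LHS]card_ord -prodr_const {1}(galg_sum_elt k).
  rewrite bigA_distr_bigA (big_morph L L_D L_0); apply: eq_bigr => u _.
  by rewrite scaler_prod -galg_elt_prod L_Z.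
(* After [q] rotations every word returns, so rotation generates a p-group. *)
pose r : {perm {ffun 'I_q -> gT}} := perm (@rot_ffun_inj q).
have r_p : p.-group <[r]>.
  suffices rq : (r ^+ q = 1)%g.
    have: (#[r]%g %| q)%N by rewrite order_dvdn rq.
    by move/pnat_dvd; apply; rewrite pnatX pnat_id.
  apply/permP=> u; rewrite perm1 permX (eq_iter (permE _)).
  apply/ffunP=> i; rewrite iter_rot_ffun; congr (u _); apply: val_inj.
  by rewrite /= iter_ordS modnDr modn_small.
have w0 (u : {ffun 'I_q -> gT}) : ~~ [forall i, u i \in H] -> w u = 0.
  case/forallPn=> i /kH ki0; rewrite /w (bigD1 i) //= ki0.
  by rewrite !mul0r.
(* [f] is conjugation-invariant only inside [H]; words with a letter outside [H] have weight 0 and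
   are dropped. *)
pose S := [set u : {ffun 'I_q -> gT} | [forall i, u i \in H]].
have wr (u : {ffun 'I_q -> gT}) : u \in S -> (r u \in S) && (w (r u) == w u).
  rewrite inE => /forallP uH; rewrite inE; apply/andP; split.
    by apply/forallP=> i; rewrite permE ffunE.
  rewrite /w permE; apply/eqP; congr (_ * _).
    rewrite [RHS](reindex_inj (@ordS_inj q)) /=.
    by apply: eq_bigr => i _; rewrite ffunE.
  rewrite (eq_bigr (fun i => u (ordS i))) => [|i _]; last by rewrite ffunE.
  move: (u) uH q_gt0; clearbody q; case: (q) => // m v vH _.
  by rewrite prod_ordS fJ ?group_prod.
transitivity (\sum_(u in S) w u).
  rewrite [RHS]big_mkcond /=; apply: eq_bigr => u _; rewrite inE.
  by case: ifPn => // /w0.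
have actS : [acts <[r]>, on S | 'P].
  rewrite cycle_subG !inE; apply/subsetP=> u /wr/andP[ruS _].
  by rewrite inE.
have wP : {in <[r]> & S, forall z u, w ('P%act u z) = w u}.
  move=> _ u /cycleP[m ->]; elim: m => [|m IHm] Su; first by rewrite act1.
  rewrite expgSr actM -(IHm Su); apply/eqP.
  have /wr/andP[_ //] : 'P%act u (r ^+ m)%g \in S.
  by rewrite (acts_act actS) ?mem_cycle.
rewrite (sum_pgroup_fix pF r_p actS wP) afix_cycle.
(* Rotation-fixed words are constant, hence determined by their letter at [i0]. *)
pose i0 := Ordinal q_gt0.
rewrite (reindex_onto (fun g => [ffun=> g]) (fun u => u i0)) /=; last first.
  move=> u /setIP[_ /afix1P ru]; apply/ffunP=> i; rewrite ffunE.
  have iu m : u (iter m (@ordS q) i0) = u i0.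
    elim: m => //= m <-; rewrite -[in RHS]ru /=.
    by rewrite /aperm permE ffunE.
  rewrite -(iu i); suffices -> : iter i (@ordS q) i0 = i by [].
  by apply: val_inj; rewrite /= iter_ordS add0n modn_small.
rewrite [RHS](bigID (mem H)) /= [X in _ + X]big1 ?addr0; last first.
  move=> g /kH ->.
  by rewrite expr0n -/q gtn_eqF // mul0r.
apply: eq_big => [g | g _].
  rewrite in_setI [_ \in S]inE ffunE eqxx andbT.
  apply/andP/idP=> [[/forallP/(_ i0)] | Hg].
    by rewrite ffunE.
  split; first by apply/forallP=> i; rewrite ffunE.
  apply/afix1P; rewrite /= /aperm permE.
  by apply/ffunP=> i; rewrite !ffunE.
rewrite /w (eq_bigr (fun=> k g)) => [|i _]; last by rewrite ffunE.
rewrite prodr_const card_ord; congr (_ * f _).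
rewrite (eq_bigr (fun=> g)) => [|i _]; last by rewrite ffunE.
by rewrite prodg_const card_ord.
Qed.

(** It suffices that p^n kills all p-parts and is 1 modulo the p'-part of the group order. [N] lets
    n exceed a nilpotency index. *)
Lemma exp_pX_constt N :
  exists2 n, (N <= n)%N & forall g : gT, (g ^+ (p ^ n) = g.`_p^')%g.
Proof.
have p_pr := pcharf_prime pF; pose m := #|[set: gT]|.
have m_gt0 : (0 < m)%N by apply: cardG_gt0.
have phi_gt0 : (0 < totient m`_p^')%N by rewrite totient_gt0 part_gt0.
(* The totient gives the congruence by Euler's theorem; being positive, it keeps the product above
   [N] and [logn p m]. *)
exists (totient m`_p^' * (N + logn p m))%N => [|g].
  by rewrite (leq_trans (leq_addr (logn p m) N)) // leq_pmull.
have dvd_m (x : gT) : (#[x]%g %| m)%N by apply: order_dvdG; rewrite inE.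
rewrite -{1}(consttC p g) expgMn; last exact: commuteX2.
have -> : (g.`_p ^+ (p ^ (totient m`_p^' * (N + logn p m))) = 1)%g.
  apply/eqP; rewrite -order_dvdn -(part_pnat_id (p_elt_constt p g)).
  apply: dvdn_trans (partn_dvd p m_gt0 (dvd_m _)) _.
  by rewrite p_part dvdn_exp2l // (leq_trans (leq_addl N _)) // leq_pmull.
rewrite mul1g -[RHS]expg1; apply/eqP; rewrite eq_expg_mod_order.
have dvd_m' : (#[g.`_p^'] %| m`_p^')%N.
  rewrite -(part_pnat_id (p_elt_constt p^' g)).
  exact: partn_dvd (dvd_m _).
have co_p : coprime p m`_p^'.
  by rewrite coprime_sym; apply: p'nat_coprime (pnat_id p_pr); apply: part_pnat.
have mod1 : (p ^ totient m`_p^' = 1 %[mod #[g.`_p^']%g])%N.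
  by rewrite -(modn_dvdm (p ^ _) dvd_m') Euler_exp_totient // modn_dvdm.
by apply/eqP; rewrite expnM -modnXm mod1 modnXm exp1n.
Qed.

(* The power map sends [g] to its p'-part and kills [k], while [a -> a ^+ q]
   is additive on [F]; so the sum to be computed has zero q-th power. *)
Lemma nilpotent_section_sum (H : {group gT}) (k : FG) (f : gT -> F) N :
    k ^+ N = 0 -> (forall g, g \notin H -> k g = 0) ->
    {in H &, forall x y, f (x ^ y)%g = f x} ->
    {in H, forall x, f x.`_p^' = f x} ->
  \sum_g k g * f g = 0.
Proof.
move=> kN0 kH fJ fp'; have [n leNn expn_p'] := exp_pX_constt N.
pose q := (p ^ n)%N; have p_pr := pcharf_prime pF.
have q_gt0 : (0 < q)%N by rewrite expn_gt0 prime_gt0.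
have qF : [pchar F].-nat q.
  by rewrite (eq_pnat _ (pcharf_eq pF)) pnatX pnat_id.
apply: contraTeq q_gt0 => nz_sum; rewrite -leqNgt leqn0; apply: contraT => nz_q.
case/negP: (expf_neq0 q nz_sum); apply/eqP.
have -> : (\sum_g k g * f g) ^+ q = \sum_g (k g * f g) ^+ q.
  apply: (big_morph (fun x => x ^+ q)) => [x y|]; first exact: exprDn_pchar.
  by rewrite expr0n (negPf nz_q).
pose f' g : F := f g ^+ q.
transitivity (\sum_g (k ^+ q) g * f' g).
  rewrite (sum_classfun_pow _ kH) => [|x y Hx Hy]; last by rewrite /f' fJ.
  apply: eq_bigr => g _; have [Hg|/kH->] := boolP (g \in H).
    by rewrite exprMn /f' expn_p' fp'.
  by rewrite mul0r expr0n (negPf nz_q) mul0r.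
apply: big1 => g _; suffices -> : k ^+ q = 0 by rewrite ffunE mul0r.
have leNq : (N <= q)%N.
  by rewrite (leq_trans leNn) // ltnW // ltn_expl // prime_gt1.
by rewrite -(subnK leNq) exprD kN0 mulr0.
Qed.

End PowerMap.

(** * The Brauer map *)

Section LoewyFiltration.

Variable p : nat.
Hypothesis pF : p \in [pchar F].

Definition galg_res (A : {set gT}) (a : FG) : FG :=
  [ffun g => if g \in A then a g else 0].

Lemma galg_resE (A : {set gT}) a g :
  galg_res A a g = (if g \in A then a g else 0) :> F.
Proof. by rewrite ffunE. Qed.

(* Restriction to the centralizer of a p-subgroup is the Brauer map. *)
Lemma galg_res_mul (E : {group gT}) a b :
    p.-group E -> {in E, forall h, GRing.comm a (galg_elt h)} ->
    {in E, forall h, GRing.comm b (galg_elt h)} ->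
  galg_res 'C(E) (a * b) = galg_res 'C(E) a * galg_res 'C(E) b.
Proof.
move=> pE aE bE; apply/ffunP=> g.
rewrite galg_resE [RHS]galg_mulE; case: ifPn => Cg; last first.
  rewrite big1 // => x _; rewrite !galg_resE.
  case: ifPn => Cx; last by rewrite mul0r.
  by rewrite groupMl ?groupV // (negPf Cg) mulr0.
rewrite galg_mulE (eq_bigl (mem [set: gT])) => [|x]; last by rewrite /= in_setT.
(* Conjugation by [E] has fixed points ['C(E)]; the terms are invariant because [a] and [b] commute
   with [E] and [g] centralizes it. *)
have actE : [acts E, on [set: gT] | 'J] by apply/actsP=> h _ x; rewrite !inE.
rewrite (sum_pgroup_fix pF pE actE) => [|h x Eh _]; last first.
  rewrite /= galg_commJ; last exact: aE.
  have {1}-> : (g = g ^ h)%g by rewrite conjgE (centP Cg) ?mulKg.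
  by rewrite -conjVg -conjMg galg_commJ //; apply: bE.
rewrite setTI afixJ big_mkcond; apply: eq_bigr => x _; rewrite !galg_resE.
by case: ifPn => Cx; rewrite ?mul0r // groupMl ?groupV // Cg.
Qed.

Lemma galg_resX (E : {group gT}) a n :
    p.-group E -> {in E, forall h, GRing.comm a (galg_elt h)} ->
  galg_res 'C(E) (a ^+ n) = galg_res 'C(E) a ^+ n.
Proof.
move=> pE aE; elim: n => [|n IHn].
  apply/ffunP=> g; rewrite galg_resE !galg_oneE.
  by have [->|_] := eqVneq g 1%g; rewrite ?group1 //= if_same.
rewrite !exprS galg_res_mul ?IHn // => h Eh.
exact/commr_sym/commrX/commr_sym/aE.
Qed.

(** * Annihilators of powers of augmentation ideals *)

(** For a group [M] this says b I(M)^n = 0, as n-fold products of elements m - 1 span I(M)^n. *)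
Definition aug_annihilated n (M : {set gT}) b :=
  forall s : seq gT, size s = n -> {subset s <= M} ->
    b * \prod_(m <- s) (galg_elt m - 1) = 0.

Lemma aug_annihilated_leq n n' (M : {set gT}) b :
  (n <= n')%N -> aug_annihilated n M b -> aug_annihilated n' M b.
Proof.
move=> le_nn' annb s sz_s sM; rewrite -(cat_take_drop n s) big_cat mulrA.
rewrite annb ?mul0r ?size_takel ?sz_s // => m /mem_take; apply: sM.
Qed.

Lemma comm_aug_prod (M : {set gT}) h (s : seq gT) :
    h \in 'C(M)%g -> {subset s <= M} ->
  GRing.comm (galg_elt h : FG) (\prod_(m <- s) (galg_elt m - 1)).
Proof.
move=> Ch sM; rewrite big_seq; apply: big_ind => [|x y|m /sM Mm].
- exact: commr1.
- exact: commrM.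
apply: commrB; last exact: commr1.
by rewrite /GRing.comm -!galg_eltM (centP Ch).
Qed.

(** Pigeonhole: ah - 1 = (a - 1)h + (h - 1) charges each factor to [A] or [K], and i + k + 1 factors
    include i + 1 of the first kind or k + 1 of the second. The induction absorbs the charged factor
    into [b], lowering i or k. *)
Lemma aug_annihilated_mul (A K : {group gT}) i k b :
    abelian K -> K \subset 'C(A)%g ->
    aug_annihilated i.+1 A b -> aug_annihilated k.+1 K b ->
  aug_annihilated (i + k).+1 (A * K)%g b.
Proof.
move=> abK cAK; have [n] := ubnP (i + k)%N; elim: n i k b => // n IHn i k b.
move=> le_n annA annK [|m s] //= [sz_s] sM.
have /mulsgP[a h Aa Kh def_m] := sM m (mem_head m s).
have {}sM : {subset s <= (A * K)%g} by move=> x xs; rewrite sM // inE xs orbT.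
have cA (r : seq gT) : {subset r <= A} ->
    GRing.comm (galg_elt h : FG) (\prod_(m <- r) (galg_elt m - 1)).
  by apply: comm_aug_prod; apply: (subsetP cAK).
have cK (r : seq gT) : {subset r <= K} ->
    GRing.comm (galg_elt a : FG) (\prod_(m <- r) (galg_elt m - 1)).
  by apply: comm_aug_prod; rewrite centsC in cAK; apply: (subsetP cAK).
have cah : GRing.comm (galg_elt a : FG) (galg_elt h).
  by rewrite /GRing.comm -!galg_eltM (centP (subsetP cAK h Kh)).
rewrite big_cons mulrA.
have -> : galg_elt m - 1 =
    (galg_elt a - 1) * galg_elt h + (galg_elt h - 1) :> FG.
  by rewrite def_m galg_eltM mulrBl mul1r addrA subrK.
rewrite mulrDr mulrDl [X in X + _](_ : _ = 0) ?add0r; last first.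
  case: i => [|i] in le_n annA annK sz_s *.
    have := annA [:: a] erefl; rewrite big_seq1 mulrA => ->; rewrite ?mul0r //.
    by move=> x; rewrite inE => /eqP->.
  apply: (IHn i k) => //.
  - move=> r sz_r rA; rewrite -!mulrA cA // 2!mulrA -(mulrA b).
    have := annA (a :: r); rewrite big_cons => -> //=; rewrite ?mul0r ?sz_r //.
    by move=> x; rewrite inE => /predU1P[-> | /rA].
  (* The stray h must pass the factors from [K], which is why [K] is abelian. *)
  - move=> r sz_r rK; rewrite -!mulrA (mulrA (galg_elt a - 1)).
    have -> : (galg_elt a - 1) * galg_elt h * \prod_(m <- r) (galg_elt m - 1) =
      \prod_(m <- r) (galg_elt m - 1) * ((galg_elt a - 1) * galg_elt h) :> FG.
      have car :
          GRing.comm (galg_elt a - 1 : FG) (\prod_(m <- r) (galg_elt m - 1)).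
        by rewrite /GRing.comm mulrBl mul1r mulrBr mulr1 cK.
      have chr : GRing.comm (galg_elt h : FG) (\prod_(m <- r) (galg_elt m - 1)).
        by apply: comm_aug_prod rK; apply: (subsetP abK).
      by rewrite -mulrA chr !mulrA car.
    by rewrite mulrA annK ?mul0r.
case: k => [|k] in le_n annA annK sz_s *.
  have := annK [:: h] erefl; rewrite big_seq1 => ->; rewrite ?mul0r //.
  by move=> x; rewrite inE => /eqP->.
rewrite addnS in le_n sz_s; apply: (IHn i k) => //.
- move=> r sz_r rA; rewrite -mulrA.
  have -> : (galg_elt h - 1) * \prod_(m <- r) (galg_elt m - 1) =
      \prod_(m <- r) (galg_elt m - 1) * (galg_elt h - 1) :> FG.
    by rewrite mulrBl mul1r mulrBr mulr1 cA.
  by rewrite mulrA annA ?mul0r.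
- move=> r sz_r rK; rewrite -mulrA.
  have := annK (h :: r); rewrite big_cons => -> //=; rewrite ?mul0r ?sz_r //.
  by move=> x; rewrite inE => /predU1P[-> | /rK].
Qed.

(** Each h^i - 1 is a multiple of h - 1, and (h - 1)^(p^k) = h^(p^k) - 1 = 0 in characteristic p. *)
Lemma aug_annihilated_cycle h k :
  #[h]%g = (p ^ k)%N -> aug_annihilated (p ^ k) <[h]>%g 1.
Proof.
move=> oh s sz_s sh; rewrite mul1r.
have pFG : p \in [pchar FG] by rewrite pchar_lalg.
pose X : FG := galg_elt h.
have [r ->] : exists r, \prod_(m <- s) (galg_elt m - 1) = (X - 1) ^+ size s * r.
  elim: s sh {sz_s} => [|m s IHs] sh; first by exists 1; rewrite big_nil mulr1.
  have [|r] := IHs; first by move=> x xs; rewrite sh // inE xs orbT.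
  have /cycleP[i ->] := sh m (mem_head m s).
  rewrite big_cons => ->; pose S := \sum_(l < i) X ^+ l.
  have SX : GRing.comm S ((X - 1) ^+ size s).
    apply/commrX/commr_sym/commr_sum => l _; apply/commrX/commr_sym.
    by apply: commrB; [apply: commr_refl | apply: commr1].
  exists (S * r); rewrite galg_eltX subrX1 -/X -/S exprS -!mulrA.
  by rewrite (mulrA S) SX -!mulrA.
rewrite sz_s; suffices -> : (X - 1) ^+ (p ^ k) = 0 by rewrite mul0r.
have -> : (X - 1) ^+ (p ^ k) = X ^+ (p ^ k) - 1.
  elim: (k) => [|l IHl]; first by rewrite !expr1.
  rewrite expnSr exprM IHl -!(pFrobenius_autE pFG) pFrobenius_autB_comm.
    by rewrite !pFrobenius_autE expr1n -exprM.
  exact: commr1.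
by rewrite -galg_eltX -oh expg_order subrr.
Qed.

(** Cyclic factors are split off one by one, using |A| + |K| - 1 <= |A| |K|. *)
Lemma aug_annihilated_abelian (M : {group gT}) :
  p.-group M -> abelian M -> aug_annihilated #|M| M 1.
Proof.
move=> pM abM; have [r defM _] := abelian_structure abM.
elim: r M pM abM defM => [|h r IHr] M pM abM.
  rewrite big_nil => <- s; rewrite cards1.
  case: s => [|m [|]] //= _ /(_ m (mem_head m _))/set1P->.
  by rewrite big_seq1 subrr mulr0.
rewrite big_cons => defM; have [[_ K _ defK] mulM cKh _] := dprodP defM.
rewrite defK in defM mulM cKh.
have sKM : K \subset M by rewrite -mulM mulG_subr.
have := IHr K (pgroupS sKM pM) (abelianS sKM abM) defK.
have h_p : p.-elt h.
  by apply: mem_p_elt pM _; rewrite -cycle_subG -mulM mulG_subl.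
have /p_natP[k oh] := h_p.
have := aug_annihilated_cycle oh; rewrite -oh -mulM TI_cardMg; last first.
  by case/dprodP: defM.
have := order_gt0 h; have := cardG_gt0 K; rewrite -/(#[h])%g.
case: #|K| => // b _; case: #[h]%g => // a _ annh annK.
apply: aug_annihilated_leq (aug_annihilated_mul _ cKh annh annK); first by lia.
exact: abelianS sKM abM.
Qed.

Lemma aug_annihilated_noncyclic (M : {group gT}) d :
    #|M| = (p ^ d)%N -> abelian M -> ~~ cyclic M ->
  aug_annihilated (p ^ (d - 1) + p - 1) M 1.
Proof.
move=> oM abM ncM; have p_pr := pcharf_prime pF.
have pM : p.-group M by rewrite /pgroup oM pnatX pnat_id.
have [r defM tyM] := abelian_structure abM.
(* Entries of the abelian type exceed 1, so the cyclic factor split off is nontrivial. *)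
have := abelian_type_gt1 M; rewrite -tyM.
case: r defM {tyM} => [|h r].
  by rewrite big_nil => M1; rewrite -M1 cyclic1 in ncM.
rewrite big_cons => defM /andP[/= h_gt1 _].
have [[_ K _ defK] mulM cKh tiKh] := dprodP defM.
rewrite defK in mulM cKh tiKh.
have sKM : K \subset M by rewrite -mulM mulG_subr.
have abK := abelianS sKM abM; have pK := pgroupS sKM pM.
have h_p : p.-elt h.
  by apply: mem_p_elt pM _; rewrite -cycle_subG -mulM mulG_subl.
have /p_natP[i oh] := h_p; have /p_natP[k oK] := pK.
have i_gt0 : (0 < i)%N by case: (i) oh h_gt1 => // ->.
have k_gt0 : (0 < k)%N.
  case: (k) oK => // /card1_trivg K1.
  by rewrite -mulM K1 mulg1 cycle_cyclic in ncM.
have def_d : d = (i + k)%N.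
  apply/eqP; rewrite -(eqn_exp2l _ _ (prime_gt1 p_pr)) -oM -mulM TI_cardMg //.
  by rewrite -/(#[h])%g oh oK expnD.
have := aug_annihilated_abelian pK abK; have := aug_annihilated_cycle oh.
have px_gt0 x : (0 < p ^ x)%N by rewrite expn_gt0 prime_gt0.
rewrite oK -(prednK (px_gt0 i)) -(prednK (px_gt0 k)) -mulM => annh annK.
apply: aug_annihilated_leq (aug_annihilated_mul abK cKh annh annK).
rewrite def_d; case: i i_gt0 {oh annh def_d} => // i _.
case: k k_gt0 {oK annK} => // k _.
have -> : (i.+1 + k.+1 - 1 = (i + k).+1)%N by lia.
rewrite !expnS expnD.
have := px_gt0 i; have := px_gt0 k; have := prime_gt1 p_pr.
move: (p ^ i)%N (p ^ k)%N => u v p_gt1 v_gt0 u_gt0.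
(* Here u and v are the orders of [<[h]>] and [K] divided by p; u + v <= uv + 1 amounts to (u - 1)(v
   - 1) >= 0. *)
have: (p * (u + v) <= p * (u * v + 1))%N by rewrite leq_mul2l; nia.
by rewrite !mulnDr muln1; lia.
Qed.

(** * Induction over powers of the radical *)

Variable D : {group gT}.

(** The inductive claim; [E] and [b] vary because each step enlarges [E] by a p-element and changes
    [b]. If no conjugate of [D] contains [E], the last condition on [b] is vacuous. *)
Definition locally_annihilated n x :=
  forall (E : {group gT}) b, p.-group E -> abelian E ->
    (forall g, g \notin E -> b g = 0) ->
    (forall (M : {group gT}) z, abelian M -> M \subset D :^ z ->
       E \subset M -> aug_annihilated n M b) ->
  {in 'C(E), forall g, (b * x) g = 0}.

(** The coefficient of jc at g, with c = bx, pairs a translate of the Brauer image of [j] with c.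
    The translate is nilpotent and c is constant on p-sections of the centralizer, so the pairing
    vanishes. *)
Lemma locally_annihilated_mul n j x N :
    (forall a, GRing.comm j a) -> (forall a, GRing.comm x a) -> j ^+ N = 0 ->
  locally_annihilated n x -> locally_annihilated n.+1 (j * x).
Proof.
move=> Zj Zx jN0 annx E b pE abE bE annb g Cg; pose c := b * x.
have cC : {in 'C(E), forall h, GRing.comm c (galg_elt h)}.
  move=> h Ch; apply/commr_sym/commrM; last exact/commr_sym/Zx.
  exact/commr_sym/(galg_supp_comm bE).
have jE : {in E, forall h, GRing.comm j (galg_elt h)} by move=> h _; apply: Zj.
pose k := galg_elt g^-1 * galg_res 'C(E) j.
have kC h : h \notin 'C(E) -> k h = 0.
  by move=> nCh; rewrite galg_mul_eltl invgK galg_resE groupMl // (negPf nCh).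
(* The Brauer map preserves nilpotency, and translation by g^-1 commutes with the image of the
   central element [j]. *)
have k0 : k ^+ N = 0.
  rewrite exprMn_comm; last first.
    apply/ffunP=> h; rewrite galg_mul_eltl galg_mul_eltr !invgK !galg_resE.
    rewrite groupMl // groupMr //; case: ifP => // _.
    by rewrite -(galg_commJ (h * g) (Zj (galg_elt g^-1))) conjgE invgK mulgK.
  have -> : galg_res 'C(E) j ^+ N = 0.
    by rewrite -galg_resX // jN0; apply/ffunP=> h; rewrite !ffunE if_same.
  by rewrite mulr0.
transitivity (\sum_h k h * c h^-1%g); last first.
  apply: (nilpotent_section_sum pF k0 kC) => [y z Cy Cz | y Cy].
    by rewrite -conjVg galg_commJ //; apply: cC.
  rewrite -consttV -[in RHS](consttC p y^-1%g).
  set t := (_.`_p)%g; set s := (_.`_p^')%g.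
  have Ct : t \in 'C(E)%g by rewrite groupX ?groupV.
  have Cs : s \in 'C(E)%g by rewrite groupX ?groupV.
  have cEt : <[t]>%g \subset 'C(E)%g by rewrite cycle_subG.
  (* [Q] is an abelian p-group because t centralizes [E], and s centralizes [Q]. *)
  pose Q := (E <*> <[t]>)%G; pose b' := (galg_elt t^-1 - 1) * b.
  have Qt : t \in Q by rewrite (subsetP (joing_subr _ _)) ?cycle_id.
  have sEQ : E \subset Q by apply: joing_subl.
  suffices: (b' * x) s = 0.
    rewrite /b' mulrBl mul1r mulrBl -mulrA -/c galg_subE galg_mul_eltl invgK.
    by move/eqP; rewrite subr_eq0 => /eqP.
  apply: (annx Q) => [||h nQh|M z abM sMD sQM r rn rM|].
  - by rewrite /= cent_joinEr // pgroupM pE; apply: p_elt_constt.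
  - by rewrite /= abelianY abE cycle_abelian.
  - have nEh g' : g' \in Q -> b (g' * h)%g = 0.
      move=> Qg'; apply: bE; apply: contra nQh => /(subsetP sEQ).
      by rewrite groupMl.
    rewrite /b' mulrBl mul1r galg_subE galg_mul_eltl invgK nEh //.
    by rewrite -[h]mul1g nEh // subrr.
  - have ct : GRing.comm b (galg_elt t^-1).
      by apply: (galg_supp_comm bE); rewrite groupV.
    have ->: b' = b * (galg_elt t^-1 - 1).
      by rewrite /b' mulrBl mulrBr mul1r mulr1 ct.
    (* An n-fold product after [b'] is an (n + 1)-fold one after [b], its first factor t^-1 - 1
       coming from [M] since [Q] does. *)
    have := annb M z abM sMD (subset_trans sEQ sQM) (t^-1 :: r)%g.
    rewrite big_cons mulrA; apply=> [|m].
      by rewrite /= rn.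
    rewrite inE => /predU1P[-> | /rM //].
    by rewrite groupV (subsetP sQM).
  - rewrite /= centY inE Cs cent_cycle; apply/cent1P.
    exact: commuteX2.
have <- : galg_res 'C(E) (j * c) g = (b * (j * x)) g.
  by rewrite galg_resE Cg mulrA -(Zj b) -mulrA.
rewrite galg_res_mul // => [|h Eh]; last first.
  by apply: cC; apply: (subsetP abE).
(* Replacing the summation variable by gh turns the convolution at g into the pairing. *)
rewrite galg_mulE (reindex_inj (mulgI g)) /=; apply: eq_bigr => h _.
rewrite galg_mul_eltl invgK invMg mulgKV !galg_resE groupMl // groupV.
by case: (h \in _); rewrite ?mul0r.
Qed.

Lemma locally_annihilated_trace c :
  galg_fixed D c -> locally_annihilated 0 (galg_trace D c).
Proof.
move=> fixc E b pE abE bE annb g Cg.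
have [[z sED] | nED] := pselect (exists z, E \subset D :^ z).
  have /(_ [::] erefl) := annb E z abE sED (subxx _).
  by rewrite big_nil mulr1 => -> //; rewrite mul0r ffunE.
have conjE a x h : galg_conj a x h = a (x * h * x^-1)%g :> F.
  by rewrite /galg_conj galg_mul_eltr galg_mul_eltl invgK mulgA.
have e0 h : h \in 'C(E)%g -> galg_trace D c h = 0.
  move=> Ch; pose f (X : {set gT}) : F := c (repr X * h * (repr X)^-1)%g.
  have -> : galg_trace D c h = \sum_(X in rcosets D [set: gT]) f X.
    by rewrite sum_ffunE; apply: eq_bigr => X _; rewrite conjE.
  have fD y x : x \in D :* y -> c (x * h * x^-1)%g = c (y * h * y^-1)%g.
    case/rcosetP=> u Du ->; rewrite -[in RHS](fixc u Du) conjE.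
    by rewrite invMg !mulgA.
  have actE : [acts E, on rcosets D [set: gT] | 'Rs].
    exact: subset_trans (subsetT _) (actsRs_rcosets _ _).
  (* A coset Dy fixed by [E] would put [E] inside the conjugate of [D] by y, so no coset is fixed
     and the sum vanishes. *)
  rewrite (sum_pgroup_fix pF pE actE) => [|u X Eu /rcosetsP[y _ ->]].
    apply: big1 => X /setIP[/rcosetsP[y _ ->]].
    by rewrite sub_afixRs_norms => sED; case: nED; exists y.
  rewrite /f /= rcosetE -rcosetM !(fD _ _ (mem_repr_rcoset _ _)).
  by rewrite invMg !mulgA -(mulgA y) -(centP Ch u Eu) !mulgA mulgK.
rewrite galg_mulE big1 // => h _.
have [Eh|/bE->] := boolP (h \in E); last by rewrite mul0r.
by rewrite e0 ?mulr0 // groupM ?groupV // (subsetP abE).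
Qed.

Lemma locally_annihilated_linear n x y (l : F) :
  locally_annihilated n x -> locally_annihilated n y ->
  locally_annihilated n (l *: x + y).
Proof.
move=> annx anny E b pE abE bE annb g Cg.
rewrite mulrDr -scalerAr galg_linE.
by rewrite (annx E) // (anny E) // addr0 mulr0.
Qed.

End LoewyFiltration.

End GroupAlgebra.

(** * From local annihilation to the Loewy length *)

Lemma prodv_ind (F : fieldType) (aT : falgType F) (U V : {vspace aT})
    (P : aT -> Prop) :
    (forall l x y, P x -> P y -> P (l *: x + y)) ->
    {in U & V, forall u v, P (u * v)} ->
  {in (U * V)%VS, forall x, P x}.
Proof.
move=> P_lin P_mul x.
have P0 : P 0 by have := P_mul 0 0; rewrite !mem0v mulr0; apply.
rewrite /prodv unlock => /coord_span->.
apply: big_ind => [|y z Py Pz|i _] //.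
  by rewrite -[y]scale1r; apply: P_lin.
rewrite -[_ *: _]addr0; apply: P_lin => //.
rewrite -tnth_nth; have /allpairsP[[u v] /= [Uu Vv ->]] :=
  mem_tnth i (allpairs_tuple *%R (vbasis U) (vbasis V)).
by apply: P_mul; apply: vbasis_mem.
Qed.

Section Blocks.

Variables (F : fieldType) (gT : finGroupType).
Local Notation FG := (galg F gT).
Variables (p : nat) (B : {aspace FG}) (D : {group gT}).
Hypotheses (pF : p \in [pchar F]) (blockB : is_block B).
Hypothesis projD : relatively_projective D (algid B).

(** With e the block idempotent, ea lies in [B], so za = z(ea) = (ea)z = a(ez) = az. *)
Lemma block_center_central z : z \in 'Z(B)%VS -> forall a, GRing.comm z a.
Proof.
move=> /memv_capP[Bz /centvP cBz] a.
have [[Ze _ _ _] defB] := is_block_algid blockB.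
have Bea : algid B * a \in B.
  have: algid B * a \in (<[algid B]> * {:FG})%VS.
    by rewrite memv_mul ?memv_line ?memvf.
  by rewrite -defB.
have /memv_capP[_ /centvP ce] := Ze.
rewrite /GRing.comm -[in LHS](algidr Bz) -mulrA cBz // ce ?memvf //.
by rewrite -mulrA algidl.
Qed.

Lemma loewy_length_block_center N : (0 < N)%N ->
    (forall (M : {group gT}) z, abelian M -> M \subset D :^ z ->
       aug_annihilated N M (1 : FG)) ->
  (loewy_length 'Z(B)%AS <= N)%N.
Proof.
move=> N_gt0 annN; rewrite loewy_lengthP //; set J := jacobson _.
have [k /andP[_ /eqP Jk0]] := jacobson_nilpotent 'Z(B)%AS.
have sJZ : (J <= 'Z(B))%VS by have /andP[] := jacobson_left_ideal 'Z(B)%AS.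
have J_nil j : j \in J -> j ^+ k = 0.
  move=> Jj; apply/eqP; rewrite -memv0 -Jk0 -/J.
  elim: (k) => [|i IHi]; first by rewrite expv0 memv_line.
  by rewrite exprS expvSl memv_mul.
pose e := algid B.
have ZE : e \in 'Z(B)%VS by rewrite memv_cap memv_algid centv_algid.
(* J^0 is spanned by the identity of FG, not that of [B]; the factor [e] makes the base case a
   multiple of the relative trace. *)
have JN n : {in (J ^+ n)%VS, forall z, (forall a, GRing.comm (z * e) a) /\
    locally_annihilated p D n (z * e)}.
  elim: n => [|n IHn].
    move=> _ /vlineP[l ->]; rewrite -scalerAl mul1r; split.
      by move=> a; rewrite /GRing.comm -scalerAl -scalerAr block_center_central.
    have [c fixc defe] := projD; have := locally_annihilated_trace pF fixc.
    (* Writing l = (l - 1) + 1 gives le the shape of a combination of two copies of e. *)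
    rewrite -defe -[l](subrK 1) scalerDl scale1r => ann_e.
    exact: locally_annihilated_linear.
  rewrite expvSl.
  apply: prodv_ind => [l x y [Zx annx] [Zy anny] | j z Jj /IHn[Zz annz]].
    rewrite mulrDl -scalerAl; split; last exact: locally_annihilated_linear.
    move=> a; apply/commr_sym/commrD; last exact/commr_sym.
    by rewrite /GRing.comm -scalerAl -scalerAr Zx.
  have Zj := block_center_central (subvP sJZ _ Jj).
  rewrite -mulrA; split.
    by move=> a; apply/commr_sym/commrM; apply/commr_sym.
  by apply: (locally_annihilated_mul pF Zj Zz (J_nil j Jj)).
rewrite -subv0; apply/subvP=> z JNz; rewrite memv0.
have Bz : z \in B.
  have: z \in ('Z(B) ^+ N)%VS by apply: subvP JNz; apply: expvS.
  by case: (N) N_gt0 => // n _; rewrite (expv_id 'Z(B)%AS) => /memv_capP[].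
rewrite -(algidr Bz); apply/eqP/ffunP=> g; rewrite -[_ * _]mul1r.
have [_ annz] := JN N z JNz.
rewrite (annz 1%G); first by rewrite ffunE.
- exact: pgroup1.
- exact: abelian1.
- by move=> h; rewrite galg_oneE inE => /negPf->.
- by move=> M y abM sMD _; apply: annN sMD.
- by rewrite cent1T inE.
Qed.

End Blocks.

(** * The bound for non-cyclic defect groups *)

Theorem theorem1 (p d : nat) (F : closedFieldType) (gT : finGroupType)
    (B : {aspace galg F gT}) (D : {group gT}) :
  prime p -> p \in [pchar F]%R ->
  is_block B -> defect_group B D ->
  ~~ cyclic D -> #|D| = (p ^ d)%N ->
  (loewy_length 'Z(B)%AS <= p ^ (d - 1) + p - 1)%N.
Proof.
move=> p_pr pF blockB [projD _] ncD oD; have p_gt1 := prime_gt1 p_pr.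
have pd_gt0 : (0 < p ^ (d - 1))%N by rewrite expn_gt0 prime_gt0.
apply: (loewy_length_block_center pF blockB projD) => [|M z abM sMD].
  by lia.
have oDz : #|D :^ z| = (p ^ d)%N by rewrite cardJg.
have [eqM | neM] := eqVneq #|M| (p ^ d)%N.
  apply: (aug_annihilated_noncyclic pF eqM abM).
  (* Having full order, [M] is the whole conjugate of [D], hence non-cyclic. *)
  suffices -> : M :=: D :^ z by rewrite cyclicJ.
  by apply/eqP; rewrite eqEcard sMD oDz eqM /=.
have: (#|M| %| p ^ d)%N by rewrite -oDz cardSg.
case/(dvdn_pfactor _ _ p_pr) => m le_md oM.
have lt_md : (m < d)%N.
  by rewrite ltn_neqAle le_md andbT; apply: contra neM => /eqP<-; rewrite oM.
have pM : p.-group M by rewrite /pgroup oM pnatX pnat_id.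
apply: aug_annihilated_leq (aug_annihilated_abelian pF pM abM).
have : (p ^ m <= p ^ (d - 1))%N by rewrite leq_exp2l //; lia.
by rewrite oM; lia.
Qed.
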